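(* Let $T$, $\rho$, $f$ and $z_t=T(t,z_0)$ be as described in the context, and along the trajectory $z_t$ define $$l_t=\log\rho(t,z_t),\qquad \tilde l_t=\rho(t,z_t),\qquad s_t=\nabla_z\log\rho(t,z_t),\qquad H_t=\nabla_z^2\log\rho(t,z_t).$$ Then $z_t,l_t,s_t,H_t$ satisfy the following ODE dynamics for $t\ge 0$: $$\partial_t z_t=f(t,z_t),$$ $$\partial_t l_t=-\nabla_z\cdot f(t,z_t),$$ $$\partial_t s_t=-\nabla_z f(t,z_t)^{\top}s_t-\nabla_z\big(\nabla_z\cdot f(t,z_t)\big),$$ $$\partial_t H_t=-\sum_{i=1}^d s_{it}\,\nabla_z^2 f_i(t,z_t)-\nabla_z^2\big(\nabla_z\cdot f(t,z_t)\big)-H_t\,\nabla_z f(t,z_t)-\nabla_z f(t,z_t)^{\top}H_t,$$ where $s_{it}$ and $f_i$ are the $i$-th components of $s_t$ and $f$ respectively. Also, $\tilde l_t$ satisfies $$\partial_t\tilde l_t=-\big(\nabla_z\cdot f(t,z_t)\big)\,\tilde l_t .$$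
   Context: Setting: $T:[0,\infty)\times\mathbb{R}^d\to\mathbb{R}^d$ is smooth, $T_t:=T(t,\cdot)$ is invertible for every $t\ge0$, and $T_0$ is the identity map. $z_0$ is a random variable in $\mathbb{R}^d$ with smooth, strictly positive probability density $\rho_0=\rho(0,\cdot)$, and $z_t=T(t,z_0)$. The density of $z_t$ is denoted $\rho(t,\cdot)=\rho_t$, i.e. $\rho_t$ is the pushforward $T_{t\#}\rho_0$; it satisfies the Monge--Ampère equation $\rho(t,T(t,x))\det(\nabla_xT(t,x))=\rho(0,x)$. The vector field $f(t,\cdot):\mathbb{R}^d\to\mathbb{R}^d$ is defined by $f(t,T(t,x))=\partial_tT(t,x)$ for all $t$ and $x$. Notation: the gradient of a scalar function is a column vector; for a vector field $f$, $\nabla_z f$ is the Jacobian matrix with entries $(\nabla_z f)_{ij}=\partial_{z_j}f_i$; $\nabla_z\cdot$ is the divergence; $\nabla_z^2$ is the Hessian. Spatial derivatives such as $\nabla_z\log\rho(t,z_t)$ mean the spatial derivative of $\log\rho(t,\cdot)$ evaluated at $z_t$. The derivatives $\partial_t z_t,\partial_t l_t,\partial_t\tilde l_t,\partial_t s_t,\partial_t H_t$ are total time derivatives along the trajectory, with $z_0$ fixed. *)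

(* Defs.v *)
(* MathComp-Analysis *)
From mathcomp Require Import all_boot all_order all_algebra.
From mathcomp Require Import all_classical all_reals all_analysis.
Import Order.TTheory GRing.Theory Num.Theory.
Import numFieldNormedType.Exports.

Set Implicit Arguments.
Unset Strict Implicit.
Unset Printing Implicit Defensive.

Local Open Scope classical_set_scope.
Local Open Scope ring_scope.

(* For finite-dimensional V (the only use below) this is the usual class C^k:
   existence and continuity of all iterated directional derivatives. *)
Fixpoint Ck (R : realType) (V W : normedModType R) (k : nat)
    (U : set V) (F : V -> W) : Prop :=
  match k with
  | 0%N => forall x, U x -> {for x, continuous F}
  | k'.+1 => (forall x, U x -> differentiable F x) /\
             (forall v, Ck k' U ('D_v F))
  end.

(* On a set A that need not be open, smoothness means that F has, around each
   point of A, a C^oo extension to a neighborhood of that point. *)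
Definition smooth_on (R : realType) (V W : normedModType R)
    (A : set V) (F : V -> W) : Prop :=
  forall p, A p -> exists U : set V, exists G : V -> W,
    [/\ open U, U p, forall k, Ck k U G & forall q, A q -> U q -> F q = G q].

(* Derivative at t of a curve on [0, +oo[: two-sided for t > 0 and one-sided,
   from the right, for t = 0. Values of g at negative times play no role. *)
Definition is_time_derive (R : realType) (W : normedModType R)
    (g : R -> W) (t : R) (v : W) : Prop :=
  h^-1 *: (g (t + h) - g t) @[h --> within [set h | 0 <= t + h] 0^'] --> v.

Section spatial_derivatives.
Context {R : realType} {d : nat}.
Implicit Types (g : 'cV[R]_d -> R) (F : 'cV[R]_d -> 'cV[R]_d).

Definition pderiv (i : 'I_d) g : 'cV[R]_d -> R :=
  'D_(delta_mx i 0 : 'cV[R]_d) g.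

Definition grad g (z : 'cV[R]_d) : 'cV[R]_d := \col_i pderiv i g z.

Definition jac F (z : 'cV[R]_d) : 'M[R]_d :=
  \matrix_(i, j) pderiv j (fun y => F y i 0) z.

Definition divergence F (z : 'cV[R]_d) : R :=
  \sum_(i < d) pderiv i (fun y => F y i 0) z.

Definition hess g : 'cV[R]_d -> 'M[R]_d := jac (grad g).

End spatial_derivatives.

Notation borelV R d := (g_sigma_algebraType (@open 'cV[R]_d)).

(* Iterated integral with respect to the one-dimensional Lebesgue measure; on
   nonnegative Borel functions it is, by Tonelli's theorem, the integral with
   respect to the Lebesgue measure of R^d. *)
Fixpoint lebesgue_int (R : realType) (d : nat) :
    ('cV[R]_d -> \bar R) -> \bar R :=
  match d with
  | 0%N => fun g => g 0
  | n.+1 => fun g =>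
      (\int[lebesgue_measure]_x
         lebesgue_int (fun y : 'cV[R]_n => g (col_mx (x%:M : 'cV[R]_1) y)))%E
  end.

Definition has_density (R : realType) (d : nat) (dsp : measure_display)
    (Om : measurableType dsp) (P : probability Om R)
    (X : Om -> 'cV[R]_d) (p : 'cV[R]_d -> R) : Prop :=
  [/\ forall y, 0 <= p y,
      measurable_fun setT (p : borelV R d -> R) &
      forall B : set (borelV R d), measurable B ->
        P (X @^-1` B) = lebesgue_int (fun y => (p y * \1_B y)%:E)].

(* Main.v *)
From HB Require Import structures.
Require Import Defs.
From mathcomp Require Import all_boot all_order all_algebra.
From mathcomp Require Import all_classical all_reals all_analysis.
From mathcomp Require Import perm ring lra.
Import Order.TTheory GRing.Theory Num.Theory.
Import numFieldNormedType.Exports.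

Set Implicit Arguments.
Unset Strict Implicit.
Unset Printing Implicit Defensive.

Local Open Scope classical_set_scope.
Local Open Scope ring_scope.

(* Everything is pulled back along the flow: g(t, .) is studied through
   g(t, T(t, x)), which is smooth up to the boundary t = 0. If the pullback of h
   is the time derivative of the pullback of g (that is, h is the material
   derivative of g), then the material derivative of the j-th partial derivative
   of g is the j-th partial derivative of h minus sum_i (d_i g) (d_j f_i).
   Differentiating the Monge-Ampere equation in time with Jacobi's formula
   computes the material derivatives of rho and of log rho, the latter being
   - div f; applying the commutator rule once gives the equation of the score,
   and a second time that of the Hessian. The only regularity needed in the
   Eulerian variable is that the inverse of T(t, .) is differentiable, which is
   the inverse function theorem. *)

(** * Criteria for differentiability at a point *)

Section differentiability.
Context {R : realType} {V W : normedModType R}.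

(** The estimate makes [df] a first-order expansion of [f] at [x], and uniqueness of such expansions
    identifies it with ['d f x]. This form serves when the differential is known in advance, as for
    an inverse map. *)
Lemma differentiable_littleo (f : V -> W) (x : V) (df : {linear V -> W}) :
  continuous df ->
  (forall e, 0 < e -> \forall h \near (0 : V),
     `|f (h + x) - f x - df h| <= e * `|h|) ->
  differentiable f x.
Proof.
move=> dfc dfo.
have fE : f \o shift x = cst (f x) + df +o_ (0 : V) id.
  apply/eqaddoP => e e0; near=> h.
  rewrite [X in `|X|](_ : _ = f (h + x) - f x - df h); last first.
    by rewrite -addrA -opprD.
  by near: h; exact: dfo.
by apply/diff_locallyP; rewrite (diff_unique dfc fE).
Unshelve. all: by end_near. Qed.

Lemma near_eq_differentiable (f g : V -> W) (x : V) :
  {near x, f =1 g} -> differentiable f x -> differentiable g x.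
Proof.
move=> fg df; have fgx := nbhs_singleton fg.
have xh : (fun h => h + x) @ (0 : V) --> x.
  by rewrite -[X in _ --> X]add0r; apply: cvgD; [exact: cvg_id|exact: cvg_cst].
have fgh : \forall h \near (0 : V), f (h + x) = g (h + x) := xh _ fg.
have [dfc /eqaddoP dfo] := (diff_locallyP x f).1 df.
apply: (@differentiable_littleo _ _ ('d f x)) => // e e0; near=> h.
have -> : g (h + x) = f (h + x).
  by apply/esym; near: h.
rewrite -fgx; near: h.
apply: filterS (dfo e e0) => h; congr (`|_| <= _).
by rewrite -[RHS]addrA -opprD.
Unshelve. all: by end_near. Qed.

End differentiability.

(** * Class C^k *)

Section Ck_calculus.
Context {R : realType} {V : normedModType R}.
Implicit Types (W : normedModType R) (U : set V) (F G : V -> R) (k : nat).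

Lemma near_open_eq W U (F G : V -> W) x : open U -> U x ->
  (forall y, U y -> F y = G y) -> {near x, F =1 G}.
Proof. by move=> oU Ux FG; near=> y; apply: FG; near: y; exact: open_nbhs_nbhs.
Unshelve. all: by end_near. Qed.

(** Directional derivatives are local, so equality on an open set passes to them. The rules for
    ['D_v] used below hold only at points of [U]; this lemma turns them into statements about
    [Ck]. *)
Lemma Ck_eq W k U (F G : V -> W) : open U -> (forall x, U x -> F x = G x) ->
  Ck k U F -> Ck k U G.
Proof.
move=> oU; elim: k F G => [|k IH] F G FG /=.
  move=> cF x Ux; have FGx := near_open_eq oU Ux FG.
  suff : F z @[z --> x] --> F x.
    rewrite (nbhs_singleton FGx) => FGc; apply: cvg_trans FGc.
    by apply: near_eq_cvg.
  exact: cF.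
move=> [dF DF]; split=> [x Ux|v].
  exact: near_eq_differentiable (near_open_eq oU Ux FG) (dF x Ux).
apply: IH (DF v) => x Ux; apply: near_eq_derive.
exact: near_open_eq oU Ux FG.
Qed.

Lemma Ck_subset W k U U' (F : V -> W) : U' `<=` U -> Ck k U F -> Ck k U' F.
Proof.
move=> UU'; elim: k F => [|k IH] F /=; first by move=> cF x /UU'; exact: cF.
by move=> [dF DF]; split=> [x /UU'|v]; [exact: dF|exact: IH].
Qed.

Lemma CkW W k U (F : V -> W) : Ck k.+1 U F -> Ck k U F.
Proof.
elim: k F => [|k IH] F [dF DF]; first by move=> x /dF/differentiable_continuous.
by split=> // v; exact: IH.
Qed.

Lemma Ck_cst W k U (c : W) : Ck k U (fun=> c : W).
Proof.
elim: k c => [|k IH] c; first by move=> x _; exact: cvg_cst.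
split=> [x _|v]; first exact: differentiable_cst.
by rewrite (_ : 'D_v _ = fun=> 0)//; apply/funext => x; exact: derive_cst.
Qed.

Lemma CkD k U F G : open U -> Ck k U F -> Ck k U G ->
  Ck k U (fun x => F x + G x).
Proof.
move=> oU; elim: k F G => [|k IH] F G.
  by move=> cF cG x Ux; apply: cvgD; [exact: cF|exact: cG].
move=> [dF DF] [dG DG]; split=> [x Ux|v].
  by apply: differentiableD; [exact: dF|exact: dG].
apply: Ck_eq (IH _ _ (DF v) (DG v)) => // x Ux.
by rewrite [RHS]deriveD//; apply: diff_derivable; [exact: dF|exact: dG].
Qed.

Lemma CkM k U F G : open U -> Ck k U F -> Ck k U G ->
  Ck k U (fun x => F x * G x).
Proof.
move=> oU; elim: k F G => [|k IH] F G.
  by move=> cF cG x Ux; apply: cvgM; [exact: cF|exact: cG].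
move=> /[dup] CF [dF DF] /[dup] CG [dG DG]; split=> [x Ux|v].
  by apply: differentiableM; [exact: dF|exact: dG].
have H := CkD oU (IH _ _ (CkW CF) (DG v)) (IH _ _ (CkW CG) (DF v)).
apply: Ck_eq H => // x Ux.
by rewrite [RHS]deriveM//; apply: diff_derivable; [exact: dF|exact: dG].
Qed.

(** The derivative of [F^-1] is [- F^-1 * F^-1 * 'D_v F], in which [F^-1] is C^k by induction. *)
Lemma CkV k U F : open U -> (forall x, U x -> F x != 0) -> Ck k U F ->
  Ck k U (fun x => (F x)^-1).
Proof.
move=> oU F0; elim: k => [|k IH].
  by move=> cF x Ux; apply: cvgV; [exact: F0|exact: cF].
move=> /[dup] CF [dF DF]; split=> [x Ux|v].
  by apply: differentiableV; [exact: dF|exact: F0].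
have CV := IH (CkW CF).
apply: Ck_eq (CkM oU (CkM oU (Ck_cst k U (-1 : R)) (CkM oU CV CV))
  (DF v)) => //.
move=> x Ux; rewrite [RHS]deriveV; last 2 first.
- exact: F0.
- exact: diff_derivable (dF x Ux).
by rewrite mulN1r /GRing.scale/= expr2 invfM.
Qed.

Lemma differentiable_ln F x : differentiable F x -> 0 < F x ->
  differentiable (fun y => ln (F y)) x.
Proof.
move=> dF F0; apply: (differentiable_comp dF).
by apply/derivable1_diffP; have [] := is_derive1_ln F0.
Qed.

Lemma derive_ln F x v : differentiable F x -> 0 < F x ->
  'D_v (fun y => ln (F y)) x = (F x)^-1 * 'D_v F x.
Proof.
move=> dF F0; have dlF := differentiable_ln dF F0.
have dl : differentiable (@ln R) (F x).
  by apply/derivable1_diffP; have [] := is_derive1_ln F0.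
rewrite (deriveE v dlF) (diff_comp dF dl)/= -(deriveE v dF).
(* Writing the scalar ['D_v F x] as a multiple of 1 lets linearity pull it out of the differential
   of [ln]. *)
rewrite -[X in 'd _ _ X]mulr1 -[X in 'd _ _ X]/('D_v F x *: (1 : R)) linearZ/=.
rewrite -(deriveE (1 : R) dl) mulrC; congr (_ * _).
by have /@derive_val := is_derive1_ln F0.
Qed.

Lemma Ck_ln k U F : open U -> (forall x, U x -> 0 < F x) -> Ck k U F ->
  Ck k U (fun x => ln (F x)).
Proof.
move=> oU F0; case: k => [|k].
  move=> cF x Ux; apply: (continuous_comp (cF x Ux)).
  exact/continuous_ln/F0.
move=> /[dup] CF [dF DF]; split=> [x Ux|v].
  by apply: differentiable_ln; [exact: dF|exact: F0].
have FN0 x : U x -> F x != 0 by move=> /F0; rewrite lt0r => /andP[].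
apply: Ck_eq (CkM oU (CkV oU FN0 (CkW CF)) (DF v)) => // x Ux.
by rewrite derive_ln//; [exact: dF|exact: F0].
Qed.

Lemma Ck_entry m n k U (F : V -> 'M[R]_(m, n)) i j : open U ->
  Ck k U F -> Ck k U (fun x => F x i j).
Proof.
move=> oU; elim: k F => [|k IH] F.
  move=> cF x Ux.
  exact: (continuous_comp (cF x Ux) (@coord_continuous _ _ _ i j (F x))).
move=> [dF DF]; split=> [x Ux|v].
  exact: (differentiable_comp (dF x Ux) (differentiable_coord (F x) i j)).
apply: Ck_eq (IH _ (DF v)) => // x Ux.
by rewrite (derive_mx (diff_derivable (dF x Ux))) mxE.
Qed.

Lemma Ck_snd (V' : normedModType R) k U F : open U -> Ck k U F ->
  Ck k [set p : V' * V | U p.2] (fun p => F p.2).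
Proof.
move=> oU; elim: k F => [|k IH] F.
  move=> cF [x1 x] Ux.
  apply: (continuous_comp (f := snd)); first exact: cvg_snd.
  exact: cF.
move=> [dF DF]; split=> [[x1 x] Ux|[v1 v]].
  apply: (@differentiable_comp _ _ _ _ snd); last exact: dF.
  by apply: linear_differentiable => -[a b]; exact: cvg_snd.
exact: IH (DF v).
Qed.

End Ck_calculus.

(** * Symmetry of second derivatives *)

Section mean_value.
Context {R : realType} {V : normedModType R}.
Implicit Types (U : set V) (F : V -> R).

Lemma is_derive_line F (a v : V) (s : R) : derivable F (s *: v + a) v ->
  is_derive s 1 (fun s => F (s *: v + a)) ('D_v F (s *: v + a)).
Proof.
move=> dF.
have E : (fun h : R => h^-1 *: (((fun s => F (s *: v + a)) \o shift s) (h *: 1)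
      - F (s *: v + a)))
    = (fun h : R => h^-1 *: ((F \o shift (s *: v + a)) (h *: v)
      - F (s *: v + a))).
  apply/funext => h /=.
  by rewrite [h *: 1]mulr1 scalerDl -addrA.
by split; rewrite /derivable /derive E.
Qed.

Lemma mean_value_line F (a v : V) (h : R) : 0 <= h ->
  (forall s, 0 <= s <= h -> derivable F (s *: v + a) v) ->
  exists2 c, 0 <= c <= h &
    F (h *: v + a) - F a = h * 'D_v F (c *: v + a).
Proof.
move=> h0 dF.
have dl s : s \in `[0, h] ->
    is_derive s 1 (fun s => F (s *: v + a)) ('D_v F (s *: v + a)).
  by rewrite in_itv/= => /dF; exact: is_derive_line.
have dl' s : s \in `]0, h[ ->
    is_derive s 1 (fun s => F (s *: v + a)) ('D_v F (s *: v + a)).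
  by move=> /subset_itv_oo_cc; exact: dl.
have cl : {within `[0, h], continuous (fun s : R => F (s *: v + a))}.
  by apply: derivable_within_continuous => s /dl[].
have [c + E] := MVT_segment h0 dl' cl.
rewrite in_itv/= => ch; exists c => //.
by move: E; rewrite scale0r add0r subr0 mulrC.
Qed.

(** The mean value theorem is used twice: in direction [v], for the difference of [F] along two
    parallel segments [h *: u] apart, then in direction [u], for ['D_v F]. *)
Lemma second_difference U F (a u v : V) (h : R) : 0 <= h -> Ck 2 U F ->
  (forall s t, 0 <= s <= h -> 0 <= t <= h -> U (s *: u + (t *: v + a))) ->
  exists s t, [/\ 0 <= s <= h, 0 <= t <= h &
    F (h *: u + (h *: v + a)) - F (h *: u + a) - (F (h *: v + a) - F a) =
    h * (h * 'D_u ('D_v F) (s *: u + (t *: v + a)))].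
Proof.
move=> h0 [dF DF] Uh.
have hh : 0 <= h <= h by rewrite h0 lexx.
have zh : 0 <= (0 : R) <= h by rewrite h0 lexx.
pose w (s : R) (t : R) := t *: v + (s *: u + a).
have wE s t : w s t = s *: u + (t *: v + a) by rewrite /w addrCA.
have dl s t : 0 <= s <= h -> 0 <= t <= h ->
    is_derive t 1 (fun t => F (w s t)) ('D_v F (w s t)).
  move=> hs ht; apply: is_derive_line; apply: diff_derivable; apply: dF.
  by rewrite -/(w s t) wE; exact: Uh.
have dg t : t \in `[0, h] -> is_derive t 1 (fun t => F (w h t) - F (w 0 t))
    ('D_v F (w h t) - 'D_v F (w 0 t)).
  rewrite in_itv/= => ht; have := dl h t hh ht; have := dl 0 t zh ht.
  by move=> ? ?; exact: is_deriveB.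
have dg' t : t \in `]0, h[ -> is_derive t 1 (fun t => F (w h t) - F (w 0 t))
    ('D_v F (w h t) - 'D_v F (w 0 t)).
  by move=> /subset_itv_oo_cc; exact: dg.
have cg : {within `[0, h], continuous (fun t => F (w h t) - F (w 0 t))}.
  by apply: derivable_within_continuous => s /dg[].
have [t + E] := MVT_segment h0 dg' cg.
rewrite in_itv/= => ht.
have [s hs E'] : exists2 s, 0 <= s <= h & 'D_v F (h *: u + (t *: v + a)) -
    'D_v F (t *: v + a) = h * 'D_u ('D_v F) (s *: u + (t *: v + a)).
  apply: (@mean_value_line ('D_v F) (t *: v + a) u h h0) => s hs.
  by apply: diff_derivable; apply: (DF v).1; exact: Uh.
exists s, t; split => //; rewrite -E'.
move: E; rewrite !wE !scale0r !add0r subr0 [RHS]mulrC => <-.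
by rewrite opprB opprB addrACA [RHS]addrACA; congr (_ + _); rewrite addrC.
Qed.

(** The second difference is symmetric in [u] and [v], so the two mixed derivatives take a common
    value at points arbitrarily close to [a]. If they differed at [a], continuity would put this
    value within half their distance of both. *)
Lemma derive_comm U F (a u v : V) : open U -> U a -> Ck 2 U F ->
  'D_u ('D_v F) a = 'D_v ('D_u F) a.
Proof.
move=> oU Ua CF; apply/eqP; rewrite -subr_eq0 -normr_eq0.
apply/negPn/negP => AB0.
have close (x y z : R) :
    `|x - z| < `|x - y| / 2 -> `|y - z| < `|x - y| / 2 -> False.
  rewrite [`|y - z|]distrC => H1 H2; have := ltrD H1 H2.
  by rewrite -splitr ltNge ler_distD.
set A := 'D_u ('D_v F) a; set B := 'D_v ('D_u F) a.
have e0 : 0 < `|A - B| / 2 by rewrite divr_gt0// lt0r AB0 normr_ge0.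
have [_ DF] := CF.
have cA := (cvgrPdist_lt _ _).1 ((DF v).2 u a Ua) _ e0.
have cB := (cvgrPdist_lt _ _).1 ((DF u).2 v a Ua) _ e0.
have nU : \forall x \near a, U x by exact: open_nbhs_nbhs.
have /nbhs_ballP[r /= r0 Hr] :
    nbhs a [set x | U x /\ `|A - 'D_u ('D_v F) x| < `|A - B| / 2 /\
                    `|B - 'D_v ('D_u F) x| < `|A - B| / 2].
  exact: filterI nU (filterI (cA _) (cB _)).
(* The parallelogram spanned by [h *: u] and [h *: v] then fits in the ball; the summand 1 keeps the
   denominator positive. *)
pose h := r / (2 * (1 + `|u| + `|v|)).
have p0 : 0 < 1 + `|u| + `|v|.
  by rewrite -addrA ltr_pwDl// addr_ge0.
have h0 : 0 < h by rewrite divr_gt0// mulr_gt0.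
have wr s t : 0 <= s <= h -> 0 <= t <= h ->
    ball a r (s *: u + (t *: v + a)).
  move=> /andP[s0 sh] /andP[t0 th].
  rewrite -ball_normE/= addrA opprD addrCA subrr addr0 normrN.
  rewrite (le_lt_trans (ler_normD _ _))// !normrZ !ger0_norm//.
  apply: (@le_lt_trans _ _ (h * (`|u| + `|v|))).
    by rewrite mulrDr lerD// ler_wpM2r.
  rewrite /h -mulrA mulrC; rewrite -ltr_pdivlMr// divff ?gt_eqF//.
  rewrite mulrC ltr_pdivrMr ?mulr_gt0// mul1r; nra.
have [s [t [hs ht E1]]] := second_difference (ltW h0) CF
  (fun s t hs ht => (Hr _ (wr s t hs ht)).1).
have wr' s' t' : 0 <= s' <= h -> 0 <= t' <= h ->
    ball a r (s' *: v + (t' *: u + a)).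
  by move=> hs' ht'; rewrite addrCA; exact: wr.
have [s' [t' [hs' ht' E2]]] := second_difference (ltW h0) CF
  (fun s t hs ht => (Hr _ (wr' s t hs ht)).1).
have E : 'D_u ('D_v F) (s *: u + (t *: v + a)) =
         'D_v ('D_u F) (s' *: v + (t' *: u + a)).
  apply: (mulfI (lt0r_neq0 h0)); apply: (mulfI (lt0r_neq0 h0)).
  have sw (p q r1 r2 : R) : p - q - (r1 - r2) = p - r1 - (q - r2) by ring.
  apply: etrans (esym E1) (etrans _ E2).
  by rewrite (addrCA (h *: v)) sw.
have [_ [/= H1 _]] := Hr _ (wr _ _ hs ht).
have [_ [_ /= H2]] := Hr _ (wr' _ _ hs' ht').
rewrite E in H1.
exact: close H1 H2.
Qed.

End mean_value.

(** * Inverse function theorem *)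

(* Makes matrices a [completeNormedModType]: the library declares completeness
   and the norm separately. *)
HB.instance Definition _ (R : realType) (m n : nat) :=
  Uniform_isComplete.Build 'M[R]_(m, n) cauchy_cvg.

Section matrix_norm.
Context {R : realType}.

Lemma ler_entry_norm m n (M : 'M[R]_(m, n)) i j : `|M i j| <= `|M|.
Proof.
rewrite [leRHS]/Num.Def.normr/= mx_normrE.
exact: (le_bigmax _ (fun ij => `|M ij.1 ij.2|) (i, j)).
Qed.

Lemma mx_norm_le m n (M : 'M[R]_(m, n)) (c : R) : 0 <= c ->
  (forall i j, `|M i j| <= c) -> `|M| <= c.
Proof.
move=> c0 Mc; rewrite [leLHS]/Num.Def.normr/= mx_normrE.
by apply: bigmax_le => // -[i j] _; exact: Mc.
Qed.

Lemma mulmx_bounded m n (M : 'M[R]_(m, n)) :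
  exists2 C : R, 0 < C & forall v : 'cV[R]_n, `|M *m v| <= C * `|v|.
Proof.
(* The summand 1 makes [C] positive even for a zero matrix, so that one can divide by it. *)
pose C := 1 + \sum_i \sum_j `|M i j|.
have S0 i : 0 <= \sum_j `|M i j| by exact: sumr_ge0.
have C0 : 0 < C by rewrite ltr_pwDl// sumr_ge0.
exists C => // v; apply: mx_norm_le => [|i j]; first by rewrite mulr_ge0// ltW.
rewrite mxE (le_trans (ler_norm_sum _ _ _))//.
apply: (@le_trans _ _ ((\sum_j `|M i j|) * `|v|)).
  rewrite mulr_suml; apply: ler_sum => k _.
  by rewrite normrM ler_wpM2l// ler_entry_norm.
rewrite ler_wpM2r// /C (bigD1 i)//= addrCA lerDl addr_ge0//.
exact: sumr_ge0.
Qed.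

Lemma mulmx_continuous m n (M : 'M[R]_(m, n)) :
  continuous (mulmx M : 'cV[R]_n -> 'cV[R]_m).
Proof.
have [C C0 MC] := mulmx_bounded M.
apply/linear_bounded_continuous/bounded_funP => r; exists (C * r) => x xr.
by rewrite (le_trans (MC x))// ler_wpM2l// ltW.
Qed.

End matrix_norm.

Section inverse_function.
Context {R : realType}.

Lemma fixed_point_ball (X : completeNormedModType R) (g : X -> X) (x0 : X)
    (r : R) : 0 <= r ->
  (forall x y, `|x0 - x| <= r -> `|x0 - y| <= r ->
     `|g x - g y| <= 2^-1 * `|x - y|) ->
  (forall x, `|x0 - x| <= r -> `|x0 - g x| <= r) ->
  exists2 p, `|x0 - p| <= r & p = g p.
Proof.
move=> r0 gl gU.
pose U : set X := closed_ball_ Num.norm x0 r.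
have gf : {homo g : x / U x} by move=> x; exact: gU.
have [] := @banach_fixed_point R X U (mkfun_fun gf); last first.
- by move=> p; exists p.
- by exists x0; rewrite /U/closed_ball_/= subrr normr0.
- exact: closed_closed_ball_.
- exists (2^-1)%:nng; split; first by rewrite /= invf_lt1// ltr1n.
  by move=> [x y] [/= Ux Uy]; exact: gl.
Qed.

Context {d : nat}.
Local Notation E := 'cV[R]_d.

Lemma cV_sum_delta (v : E) : v = \sum_j v j 0 *: delta_mx j 0.
Proof.
apply/matrixP => i j; rewrite ord1 summxE (bigD1 i)//= !mxE !eqxx mulr1.
rewrite big1 ?addr0// => k ki; rewrite !mxE eq_sym (negbTE ki).
by rewrite mulr0.
Qed.

Lemma derive_pderiv (g : E -> R) (x v : E) : differentiable g x ->
  'D_v g x = \sum_j v j 0 * pderiv j g x.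
Proof.
move=> dg; rewrite (deriveE _ dg) {1}(cV_sum_delta v) linear_sum/=.
by apply: eq_bigr => j _; rewrite linearZ/= /pderiv (deriveE _ dg).
Qed.

Lemma differentiable_entry (F : E -> E) (x : E) (i : 'I_d) :
  differentiable F x -> differentiable (fun y => F y i 0) x.
Proof.
by move=> dF; exact: (differentiable_comp dF (differentiable_coord (F x) i 0)).
Qed.

(** The mean value theorem on the segment from [x] to [y] expresses the increment of each entry by
    partial derivatives at an intermediate point, which continuity keeps close to those at [x0]. *)
Lemma strict_differentiability (F : E -> E) (x0 : E) (e : R) :
  (forall x, differentiable F x) ->
  (forall i j, {for x0, continuous (pderiv j (fun y => F y i 0))}) -> 0 < e ->
  exists2 r, 0 < r & forall x y, `|x0 - x| <= r -> `|x0 - y| <= r ->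
    `|F y - F x - jac F x0 *m (y - x)| <= e * `|y - x|.
Proof.
(* The error is a sum of [d] terms, each at most [e1] times the norm of [y - x]; [d.+1] avoids a
   division by zero when [d = 0]. *)
move=> dF cF e0; pose e1 := e / d.+1%:R.
have e10 : 0 < e1 by rewrite divr_gt0.
have : \forall x \near x0, forall i j,
    `|pderiv j (fun y => F y i 0) x0 - pderiv j (fun y => F y i 0) x| < e1.
  near=> x; move=> i; move: i; near: x; apply: filter_forall => i /=.
  near=> x; move=> j; move: j; near: x; apply: filter_forall => j /=.
  exact: ((cvgrPdist_lt _ _).1 (cF i j) _ e10).
move=> /nbhs_normP[r /= r0 Hr].
exists (r / 2); first by rewrite divr_gt0.
have r2 : r / 2 < r by lra.
move=> x y xr yr; apply: mx_norm_le => [|i k].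
  by rewrite mulr_ge0// ltW.
rewrite ord1 {k}; pose g z := F z i 0.
have dg z : differentiable g z by exact: differentiable_entry.
have [c c01] := @mean_value_line R E g x (y - x) 1 ler01
  (fun s _ => diff_derivable (dg _)).
rewrite scale1r subrK mul1r => gE.
have cr : `|x0 - (c *: (y - x) + x)| < r.
  have -> : x0 - (c *: (y - x) + x) = c *: (x0 - y) + (1 - c) *: (x0 - x).
    by apply/matrixP => a b; rewrite !mxE; ring.
  move: c01 => /andP[c0 c1].
  rewrite (le_lt_trans (ler_normD _ _))// !normrZ !ger0_norm ?subr_ge0//; nra.
have -> : (F y - F x - jac F x0 *m (y - x)) i 0 = \sum_j
    (y - x) j 0 * (pderiv j g (c *: (y - x) + x) - pderiv j g x0).
  have subE (a b c' : E) : (a - b - c') i 0 = a i 0 - b i 0 - c' i 0.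
    by rewrite !mxE.
  rewrite subE mxE -/(g y) -/(g x) gE (derive_pderiv _ (dg _)) -sumrB.
  apply: eq_bigr => j _; rewrite mulrBr; congr (_ - _).
  by rewrite mxE mulrC.
rewrite (le_trans (ler_norm_sum _ _ _))//.
apply: (@le_trans _ _ (\sum_(j < d) `|y - x| * e1)).
  apply: ler_sum => j _; rewrite normrM ler_pM// ?ler_entry_norm//.
  by rewrite distrC ltW//; exact: Hr cr i j.
rewrite sumr_const card_ord -mulr_natr /e1.
rewrite -mulrA mulrC ler_wpM2r// -mulrA ler_piMr ?ltW// mulrC.
by rewrite ltr_pdivrMr// mul1r ltr_nat.
Unshelve. all: by end_near. Qed.

(* With [B] the inverse of the Jacobian at [x0], [S y] is the fixed point near
   [x0] of the contraction [x |-> x - B (F x - y)]; as [x - B (F x)] is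
   Lipschitz around [x0] with an arbitrarily small constant, [B] is the
   differential of [S]. *)
Lemma differentiable_inverse (F S : E -> E) :
  (forall x, differentiable F x) ->
  (forall i j, continuous (pderiv j (fun y => F y i 0))) ->
  (forall x, jac F x \in unitmx) ->
  cancel F S -> cancel S F -> forall y, differentiable S y.
Proof.
move=> dF cF uF FS SF y0; set x0 := S y0.
have Fx0 : F x0 = y0 by exact: SF.
pose B := invmx (jac F x0).
have BA v : B *m (jac F x0 *m v) = v by rewrite mulKmx.
have [C C0 BC] := mulmx_bounded B.
pose K x := x - B *m F x.
have KL e : 0 < e -> exists2 r, 0 < r & forall x y, `|x0 - x| <= r ->
    `|x0 - y| <= r -> `|K x - K y| <= e * `|x - y|.
  move=> e0; have eC : 0 < e / C by rewrite divr_gt0.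
  have [r r0 Hr] := strict_differentiability dF (fun i j => cF i j x0) eC.
  exists r => // x y xr yr.
  have -> : K x - K y = B *m (F y - F x - jac F x0 *m (y - x)).
    rewrite [in RHS]mulmxBr BA mulmxBr /K.
    by apply/matrixP => i j; rewrite !mxE; ring.
  rewrite (le_trans (BC _))// -ler_pdivlMl// mulrA [C^-1 * e]mulrC.
  by rewrite (distrC x); exact: Hr.
apply: (@differentiable_littleo _ _ _ S y0 (mulmx B)).
  exact: mulmx_continuous.
move=> e e0.
(* The bound 1/2 gives a contraction. The bound [e / (2 * C)] gives the final estimate, since the
   fixed point moves by at most [2 * C] times the norm of [h]. *)
pose e1 := Num.min 2^-1 (e / (2 * C)).
have e10 : 0 < e1 by rewrite lt_min invr_gt0 ltr0n/= divr_gt0// mulr_gt0.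
have [r r0 Hr] := KL e1 e10.
have hr : 0 < r / (2 * C) by rewrite divr_gt0// mulr_gt0.
have hn : \forall h \near (0 : E), `|h| <= r / (2 * C) by exact: nbhs0_le.
near=> h.
have hsmall : `|h| <= r / (2 * C).
  by near: h; exact: hn.
(* The contraction uses up half of the radius and the translation by [B *m h] the other half, so the
   ball is mapped into itself. *)
have Bh : `|B *m h| <= r / 2.
  rewrite (le_trans (BC h))// (le_trans (ler_wpM2l (ltW C0) hsmall))//.
  by rewrite invfM mulrA mulrA mulrAC [C * r]mulrC mulfK ?gt_eqF.
set y := h + y0.
have [p pr pE] : exists2 p, `|x0 - p| <= r & p = K p + B *m y.
  apply: (@fixed_point_ball _ (fun x => K x + B *m y) x0 r (ltW r0)).
  - move=> a b ar br; rewrite opprD addrACA subrr addr0.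
    by rewrite (le_trans (Hr _ _ ar br))// ler_wpM2r// ge_min lexx.
  - move=> a ar.
    have -> : x0 - (K a + B *m y) = (K x0 - K a) - B *m h.
      by rewrite /y mulmxDr /K Fx0; apply/matrixP => i j; rewrite !mxE; ring.
    rewrite (le_trans (ler_normB _ _))// [leRHS]splitr lerD//.
    have x0r : `|x0 - x0| <= r by rewrite subrr normr0 ltW.
    rewrite (le_trans (Hr _ _ x0r ar))// mulrC ler_pM ?(ltW e10)//.
    by rewrite ge_min lexx.
have Sy : S y = p.
  rewrite -[RHS]FS; congr S.
  (* This is the fixed-point equation; multiplying by the Jacobian at [x0], the inverse of [B],
     gives [F p = y]. *)
  have : B *m (y - F p) = 0.
    have cancel_fix (a b c : E) : a = a - b + c -> c - b = 0.
      by rewrite -addrA -{1}[a]addr0 => /addrI; rewrite addrC.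
    by rewrite mulmxBr; exact: cancel_fix pE.
  move=> /(congr1 (mulmx (jac F x0))); rewrite mulmx0 mulKVmx//.
  by move/eqP; rewrite subr_eq0 => /eqP.
rewrite Sy -/x0.
have E1 : p - x0 - B *m h = K p - K x0.
  rewrite [in LHS]pE /K Fx0 /y mulmxDr.
  by apply/matrixP => i j; rewrite !mxE; ring.
have x0r : `|x0 - x0| <= r by rewrite subrr normr0 ltW.
have KB : `|K p - K x0| <= e1 * `|p - x0| := Hr _ _ pr x0r.
(* The half of the norm of [p - x0] coming from the contraction is absorbed on the left. *)
have pB : `|p - x0| <= 2 * (C * `|h|).
  have : `|p - x0| <= 2^-1 * `|p - x0| + C * `|h|.
    rewrite -{1}(subrK (B *m h) (p - x0)) (le_trans (ler_normD _ _))// E1.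
    rewrite lerD// ?BC// (le_trans KB)// ler_wpM2r// ge_min lexx//.
  lra.
rewrite E1 (le_trans KB)// (le_trans (ler_wpM2l (ltW e10) pB))//.
rewrite (mulrA 2) mulrA ler_wpM2r// -ler_pdivlMr ?mulr_gt0//.
by rewrite ge_min lexx orbT.
Unshelve. all: by end_near. Qed.

End inverse_function.

(** * One-sided time derivatives *)

Section time_derivative.
Context {R : realType}.
Implicit Types (W : normedModType R) (a b : R -> R) (t : R).

Local Notation future t := (within [set h : R | 0 <= t + h] 0^').

(** Small positive increments are admissible even at [t = 0]. Properness is what makes one-sided
    derivatives unique. *)
Lemma future_filter t : 0 <= t -> ProperFilter (future t).
Proof.
move=> t0; apply: Build_ProperFilter_ex => P /= [e /= e0 He].
have e20 : 0 < e / 2 by rewrite divr_gt0.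
exists (e / 2); apply: (He (e / 2)).
- by rewrite /= sub0r normrN gtr0_norm//; lra.
- by rewrite gt_eqF.
- by rewrite /= addr_ge0// ltW.
Qed.

Lemma future_id t : (fun h : R => h) @ future t --> (0 : R).
Proof. by do 2!apply: cvg_within_filter; exact: cvg_id. Qed.

Lemma is_time_derive_unique W (g : R -> W) t v w : 0 <= t ->
  is_time_derive g t v -> is_time_derive g t w -> v = w.
Proof.
move=> t0 gv gw; have := future_filter t0 => FF.
exact: (cvg_unique (@norm_hausdorff _ W) gv gw).
Qed.

Lemma is_time_derive_eq W (g g' : R -> W) t v : 0 <= t ->
  (forall s, 0 <= s -> g s = g' s) -> is_time_derive g t v ->
  is_time_derive g' t v.
Proof.
move=> t0 gg' gv; apply: (cvg_trans _ gv); apply: near_eq_cvg.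
near=> h; have th : 0 <= t + h by near: h; exact: withinT.
by rewrite !gg'.
Unshelve. all: by end_near. Qed.

Lemma is_time_derive_cst W (c : W) t : is_time_derive (fun=> c) t 0.
Proof.
rewrite /is_time_derive (_ : (fun _ => _) = fun=> 0); first exact: cvg_cst.
by apply/funext => h; rewrite subrr scaler0.
Qed.

(** The value at [t + h] is [a t] plus [h] times the difference quotient, which converges. The
    product rule relies on this. *)
Lemma is_time_derive_continuous a t v : is_time_derive a t v ->
  a (t + h) @[h --> future t] --> a t.
Proof.
move=> av.
have H : (fun h => h * (h^-1 *: (a (t + h) - a t)) + a t) @ future t
    --> 0 * v + a t.
  exact: (cvgD (cvgM (@future_id t) av) (cvg_cst (a t))).
rewrite mul0r add0r in H; apply: (cvg_trans _ H); apply: near_eq_cvg.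
have hn : \forall h \near (0 : R)^', h != 0 by exact: nbhs_dnbhs_neq.
near=> h; have h0 : h != 0 by near: h; exact: (cvg_within _ hn).
by rewrite /GRing.scale/= mulrA divff// mul1r subrK.
Unshelve. all: by end_near. Qed.

Lemma is_time_deriveD a b t v w :
  is_time_derive a t v -> is_time_derive b t w ->
  is_time_derive (fun s => a s + b s) t (v + w).
Proof.
move=> av bw.
have H : (fun h => h^-1 *: (a (t + h) - a t) + h^-1 *: (b (t + h) - b t))
  @ future t --> v + w by exact: (cvgD av bw).
apply: (cvg_trans _ H).
rewrite (_ : (fun h => _) = (fun h => h^-1 *: (a (t + h) - a t) +
  h^-1 *: (b (t + h) - b t)))//.
by apply/funext => h /=; rewrite -scalerDr opprD addrACA.
Qed.

Lemma is_time_deriveM a b t v w :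
  is_time_derive a t v -> is_time_derive b t w ->
  is_time_derive (fun s => a s * b s) t (v * b t + a t * w).
Proof.
move=> av bw.
have H : (fun h => (h^-1 *: (a (t + h) - a t)) * b (t + h)
    + a t * (h^-1 *: (b (t + h) - b t))) @ future t --> v * b t + a t * w.
  apply: cvgD; first exact: (cvgM av (is_time_derive_continuous bw)).
  exact: (cvgM (cvg_cst (a t)) bw).
apply: (cvg_trans _ H).
rewrite (_ : (fun h => _) = (fun h => (h^-1 *: (a (t + h) - a t)) * b (t + h)
   + a t * (h^-1 *: (b (t + h) - b t))))//.
by apply/funext => h /=; rewrite /GRing.scale/=; ring.
Qed.

Lemma is_time_derive_sum (I : Type) (r : seq I) (F : I -> R -> R) t
    (dF : I -> R) :
  (forall i, is_time_derive (F i) t (dF i)) ->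
  is_time_derive (fun s => \sum_(i <- r) F i s) t (\sum_(i <- r) dF i).
Proof.
move=> H; elim: r => [|i r IH].
  under [X in is_time_derive X]eq_fun do rewrite big_nil.
  by rewrite big_nil; exact: is_time_derive_cst.
under [X in is_time_derive X]eq_fun do rewrite big_cons.
by rewrite big_cons; exact: (is_time_deriveD (H i) IH).
Qed.

(** Leibniz rule by induction on [r]. The omitted factor is designated by its index and not by its
    position, hence [uniq r]. *)
Lemma is_time_derive_prod (I : eqType) (r : seq I) (F : I -> R -> R) t
    (dF : I -> R) : uniq r ->
  (forall i, is_time_derive (F i) t (dF i)) ->
  is_time_derive (fun s => \prod_(i <- r) F i s) t
    (\sum_(i <- r) dF i * \prod_(k <- r | k != i) F k t).
Proof.
move=> + H; elim: r => [_|i r IH /= /andP[ir ur]].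
  under [X in is_time_derive X]eq_fun do rewrite big_nil.
  by rewrite big_nil; exact: is_time_derive_cst.
under [X in is_time_derive X]eq_fun do rewrite big_cons.
have := is_time_deriveM (H i) (IH ur).
congr is_time_derive; rewrite !big_cons eqxx; congr (_ + _).
  congr (_ * _); rewrite [LHS]big_seq [RHS]big_seq_cond.
  apply: eq_bigl => k; case: (boolP (k \in r)) => //= kr.
  by apply/esym; apply: contraNneq ir => <-.
rewrite mulr_sumr [LHS]big_seq [RHS]big_seq; apply: eq_bigr => k kr.
rewrite big_cons ifT; last by apply: contraNneq ir => ->.
by rewrite mulrCA.
Qed.

Lemma is_time_derive_mx m n (M : R -> 'M[R]_(m, n)) t (M' : 'M[R]_(m, n)) :
  0 <= t ->
  (forall i j, is_time_derive (fun s => M s i j) t (M' i j)) ->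
  is_time_derive M t M'.
Proof.
move=> t0 H; have := future_filter t0 => FF.
apply/cvgrPdist_le => e e0; near=> h.
apply: mx_norm_le; [exact: ltW|near: h; apply: filter_forall => i /=].
near=> h => j; move: j; near: h; apply: filter_forall => j /=.
near=> h; rewrite !mxE; near: h.
exact: ((cvgrPdist_le _ _).1 (H i j) _ e0).
Unshelve. all: by end_near. Qed.

Lemma is_time_derive_entry m n (M : R -> 'M[R]_(m, n)) t
    (M' : 'M[R]_(m, n)) i j :
  is_time_derive M t M' -> is_time_derive (fun s => M s i j) t (M' i j).
Proof.
move=> MM'.
have H : (fun h => (h^-1 *: (M (t + h) - M t)) i j) @ future t --> M' i j.
  exact: (cvg_comp _ _ MM' (@coord_continuous _ _ _ i j M')).
rewrite /is_time_derive (_ : (fun h => _) =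
  (fun h => (h^-1 *: (M (t + h) - M t)) i j))//.
by apply/funext => h; rewrite !mxE.
Qed.

(* Jacobi's formula. The derivative of the determinant is the sum over the rows
   of the determinants in which that row is replaced by its derivative. *)
Lemma is_time_derive_det n (M : R -> 'M[R]_n) t (A : 'M[R]_n) :
  (forall i j, is_time_derive (fun s => M s i j) t ((A *m M t) i j)) ->
  is_time_derive (fun s => \det (M s)) t (\det (M t) * \tr A).
Proof.
move=> H; pose M' := A *m M t.
pose N i := \matrix_(k, j) if k == i then M' k j else M t k j.
have -> : \det (M t) * \tr A = \sum_i \det (N i).
  (* Since [M *m \adj M] is the scalar matrix of the determinant. In the trace, row [i] of [M']
     meets the cofactors of row [i] of [M], which are also those of [N i]. *)
  have -> : \det (M t) * \tr A = \tr (M' *m \adj (M t)).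
    by rewrite -mulmxA mul_mx_adj mul_mx_scalar mxtraceZ.
  apply: eq_bigr => i _; rewrite (expand_det_row _ i) mxE.
  apply: eq_bigr => j _; rewrite !mxE eqxx; congr (_ * _).
  rewrite /cofactor; congr (_ * \det _).
  by apply/matrixP => k l; rewrite !mxE eq_sym (negbTE (neq_lift _ _)).
(* The Leibniz formula with the two sums exchanged: the inner sum is what the product rule yields
   for one permutation. *)
have -> : \sum_i \det (N i) = \sum_(s : 'S_n) (-1) ^+ s *
    (\sum_i M' i (s i) * \prod_(k | k != i) M t k (s k)).
  rewrite exchange_big; apply: eq_bigr => s _; rewrite mulr_sumr.
  apply: eq_bigr => i _; congr (_ * _).
  rewrite (bigD1 i)//= !mxE eqxx; congr (_ * _).
  by apply: eq_bigr => k ki; rewrite !mxE (negbTE ki).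
apply: is_time_derive_sum => s.
have := is_time_deriveM (is_time_derive_cst ((-1) ^+ s : R) t)
  (is_time_derive_prod (index_enum_uniq _) (fun i => H i (s i))).
by rewrite mul0r add0r.
Qed.

End time_derivative.

(** * Smoothness up to the initial time *)

Section smooth_future.
Context {R : realType} {V : normedModType R}.
Implicit Types (phi psi : R -> V -> R) (t : R) (x : V).

(** Curried form of smoothness on the closed half-space of nonnegative times. Proofs work on local
    extensions, where the calculus of [Ck] applies. *)
Definition smooth_future (W : normedModType R) (phi : R -> V -> W) :=
  smooth_on [set p : R * V | 0 <= p.1] (fun p => phi p.1 p.2).

Lemma smooth_future_eq phi psi : (forall t x, 0 <= t -> phi t x = psi t x) ->
  smooth_future phi -> smooth_future psi.
Proof.
move=> E phiS p p0; have [U [G [oU Up CG GE]]] := phiS p p0.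
by exists U, G; split=> // q q0 Uq; rewrite -E// GE.
Qed.

Lemma smooth_future_cst (c : R) : smooth_future (fun _ _ => c).
Proof.
move=> p p0; exists setT, (fun=> c); split=> //; first exact: openT.
by move=> k; exact: Ck_cst.
Qed.

Lemma smooth_futureD phi psi : smooth_future phi -> smooth_future psi ->
  smooth_future (fun t x => phi t x + psi t x).
Proof.
move=> phiS psiS p p0; have [U [G [oU Up CG GE]]] := phiS p p0.
have [U' [G' [oU' U'p CG' GE']]] := psiS p p0.
have oI : open (U `&` U') by exact: openI.
exists (U `&` U'), (fun q => G q + G' q); split=> //.
  move=> k; apply: CkD => //; first exact: Ck_subset (CG k).
  exact: Ck_subset (CG' k).
by move=> q q0 [Uq U'q]; rewrite GE// GE'.
Qed.

Lemma smooth_futureM phi psi : smooth_future phi -> smooth_future psi ->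
  smooth_future (fun t x => phi t x * psi t x).
Proof.
move=> phiS psiS p p0; have [U [G [oU Up CG GE]]] := phiS p p0.
have [U' [G' [oU' U'p CG' GE']]] := psiS p p0.
have oI : open (U `&` U') by exact: openI.
exists (U `&` U'), (fun q => G q * G' q); split=> //.
  move=> k; apply: CkM => //; first exact: Ck_subset (CG k).
  exact: Ck_subset (CG' k).
by move=> q q0 [Uq U'q]; rewrite GE// GE'.
Qed.

Lemma smooth_future_sum (I : Type) (r : seq I) (F : I -> R -> V -> R) :
  (forall i, smooth_future (F i)) ->
  smooth_future (fun t x => \sum_(i <- r) F i t x).
Proof.
move=> FS; elim: r => [|i r IH].
  apply: smooth_future_eq (smooth_future_cst 0) => t x _.
  by rewrite big_nil.
apply: smooth_future_eq (smooth_futureD (FS i) IH) => t x _.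
by rewrite big_cons.
Qed.

Lemma smooth_future_prod (I : Type) (r : seq I) (F : I -> R -> V -> R) :
  (forall i, smooth_future (F i)) ->
  smooth_future (fun t x => \prod_(i <- r) F i t x).
Proof.
move=> FS; elim: r => [|i r IH].
  apply: smooth_future_eq (smooth_future_cst 1) => t x _.
  by rewrite big_nil.
apply: smooth_future_eq (smooth_futureM (FS i) IH) => t x _.
by rewrite big_cons.
Qed.

(* A positive extension can be obtained by shrinking the neighborhood, since
   the extension is continuous. *)
Lemma smooth_future_pos phi : smooth_future phi ->
  (forall t x, 0 <= t -> 0 < phi t x) ->
  forall p : R * V, 0 <= p.1 -> exists U : set (R * V), exists G : R * V -> R,
    [/\ open U, U p, forall k, Ck k U G, forall q, U q -> 0 < G q &
        forall q : R * V, 0 <= q.1 -> U q -> phi q.1 q.2 = G q].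
Proof.
move=> phiS phi0 p p0; have [U [G [oU Up CG GE]]] := phiS p p0.
have nU : \forall q \near p, U q by exact: open_nbhs_nbhs.
have Gp : 0 < G p by rewrite -GE//; exact: phi0.
have cG : \forall q \near p, 0 < G q.
  by apply: (cvgr_gt _ (CG 0%N p Up)).
have nUG : nbhs p (U `&` [set q | 0 < G q]) by exact: filterI nU cG.
have sUG : (U `&` [set q | 0 < G q])° `<=` U `&` [set q | 0 < G q].
  exact: interior_subset.
exists (U `&` [set q | 0 < G q])°, G; split=> //.
- exact: open_interior.
- by move=> k; apply: Ck_subset (CG k) => q /sUG[].
- by move=> q /sUG[].
- by move=> q q0 /sUG[Uq _]; exact: GE.
Qed.

Lemma smooth_futureV phi : smooth_future phi ->
  (forall t x, 0 <= t -> 0 < phi t x) ->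
  smooth_future (fun t x => (phi t x)^-1).
Proof.
move=> phiS phi0 p p0.
have [U [G [oU Up CG G0 GE]]] := smooth_future_pos phiS phi0 p0.
exists U, (fun q => (G q)^-1); split=> //; last by move=> q q0 Uq; rewrite GE.
by move=> k; apply: CkV => // q /G0; rewrite lt0r => /andP[].
Qed.

Lemma smooth_future_ln phi : smooth_future phi ->
  (forall t x, 0 <= t -> 0 < phi t x) ->
  smooth_future (fun t x => ln (phi t x)).
Proof.
move=> phiS phi0 p p0.
have [U [G [oU Up CG G0 GE]]] := smooth_future_pos phiS phi0 p0.
exists U, (fun q => ln (G q)); split=> //; last by move=> q q0 Uq; rewrite GE.
by move=> k; exact: Ck_ln.
Qed.

Lemma smooth_future_det n (M : R -> V -> 'M[R]_n) :
  (forall i j, smooth_future (fun t x => M t x i j)) ->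
  smooth_future (fun t x => \det (M t x)).
Proof.
move=> MS; apply: smooth_future_sum => s.
by apply: smooth_futureM (smooth_future_cst _) _; exact: smooth_future_prod.
Qed.

(** Cramer's rule: the entries are cofactors divided by the determinant. *)
Lemma smooth_future_invmx n (M : R -> V -> 'M[R]_n) :
  (forall i j, smooth_future (fun t x => M t x i j)) ->
  (forall t x, 0 <= t -> 0 < \det (M t x)) ->
  forall i j, smooth_future (fun t x => invmx (M t x) i j).
Proof.
move=> MS M0 i j.
have H : smooth_future (fun t x => (\det (M t x))^-1 * ((-1) ^+ (j + i) *
    \det (row' j (col' i (M t x))))).
  apply: smooth_futureM.
    by apply: smooth_futureV => //; exact: smooth_future_det.
  apply: smooth_futureM (smooth_future_cst _) _.
  apply: smooth_future_det => k l.
  by apply: smooth_future_eq (MS (lift j k) (lift i l)) => t x _; rewrite !mxE.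
apply: smooth_future_eq H => t x t0.
by rewrite /invmx unitmxE unitfE gt_eqF ?M0//= !mxE.
Qed.

Lemma smooth_future_snd (g : V -> R) : smooth_on [set: V] g ->
  smooth_future (fun _ x => g x).
Proof.
move=> gS [t x] _; have [U [G [oU Up CG GE]]] := gS x I.
exists [set p | U p.2], (fun p => G p.2); split=> //.
- by apply: (@open_comp _ _ (@snd R V) U) => // -[a b] _; exact: cvg_snd.
- by move=> k; exact: Ck_snd.
- by move=> q _ Uq; exact: GE.
Qed.

(** * Derivatives read off from a local extension *)

Section extension.
Variables (W : normedModType R) (phi : R -> V -> W).
Variables (U : set (R * V)) (G : R * V -> W) (t : R) (x : V).
Hypotheses (oU : open U) (Utx : U (t, x)) (t0 : 0 <= t).
Hypothesis phiE : forall q : R * V, 0 <= q.1 -> U q -> phi q.1 q.2 = G q.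

Lemma slice_near : {near x, (fun y => G (t, y)) =1 phi t}.
Proof.
have c : (fun y : V => (t, y)) @ x --> (t, x).
  by apply: (@cvg_pair _ _ _ _ (nbhs t) (nbhs x) _ _ _);
    [exact: cvg_cst|exact: cvg_id].
have nU : \forall q \near (t, x), U q by exact: open_nbhs_nbhs.
near=> y; apply/esym/(phiE (q := (t, y))) => //.
near: y; exact: c nU.
Unshelve. all: by end_near. Qed.

Lemma slice_differentiable : differentiable G (t, x) ->
  differentiable (phi t) x.
Proof.
move=> dG; apply: near_eq_differentiable slice_near _.
by apply: (@differentiable_comp _ _ _ _ (fun y => (t, y))).
Qed.

(** Direction [(0, v)] leaves the time fixed, so even at [t = 0] the line stays, near its base
    point, where [phi] and [G] agree. *)
Lemma slice_derive v : 'D_v (phi t) x = 'D_(0, v) G (t, x).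
Proof.
rewrite -(near_eq_derive v slice_near) /derive.
have E : (fun h : R => h^-1 *: (((fun y => G (t, y)) \o shift x) (h *: v) -
      G (t, x))) =
    (fun h : R => h^-1 *: ((G \o shift (t, x)) (h *: (0, v)) - G (t, x))).
  apply/funext => h /=; congr (_ *: (G _ - _)).
  by congr pair; rewrite /= scaler0 add0r.
by rewrite E.
Qed.

(** [phi] and [G] agree at nonnegative times, the only ones that the filter of [is_time_derive]
    sees; the two-sided limit for [G] restricts to it. *)
Lemma time_derive_extension : derivable G (t, x) (1, 0) ->
  is_time_derive (phi ^~ x) t ('D_(1, 0) G (t, x)).
Proof.
move=> dG.
have nU : \forall q \near (t, x), U q by exact: open_nbhs_nbhs.
have ct : (fun h : R => t + h) @ (0 : R) --> t + 0.
  by apply: cvgD; [exact: cvg_cst|exact: cvg_id].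
rewrite addr0 in ct.
have c : (fun h : R => (t + h, x)) @ (0 : R) --> (t, x).
  apply: (@cvg_pair _ _ _ _ (nbhs t) (nbhs x) _ _ _); last exact: cvg_cst.
  exact: ct.
have nh : \forall h \near (0 : R), U (t + h, x) by exact: c nU.
have dG' : (fun h : R => h^-1 *: ((G \o shift (t, x)) (h *: (1, 0)) -
    G (t, x))) @ within [set h : R | 0 <= t + h] 0^' --> 'D_(1, 0) G (t, x).
  by apply: cvg_within_filter; exact: dG.
apply: (cvg_trans _ dG'); apply: near_eq_cvg; near=> h.
have th : 0 <= t + h by near: h; exact: withinT.
have Uh : U (t + h, x).
  by near: h; do 2!apply: cvg_within; exact: nh.
rewrite (phiE (q := (t + h, x)))// (phiE (q := (t, x)))//=.
congr (_ *: (G _ - _)).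
by congr pair; rewrite /= ?scaler0 ?add0r// [h *: 1]mulr1 addrC.
Unshelve. all: by end_near. Qed.

End extension.

Lemma smooth_future_slice (W : normedModType R) (phi : R -> V -> W) t x :
  0 <= t -> smooth_future phi -> differentiable (phi t) x.
Proof.
move=> t0 phiS; have [U [G [oU Up CG GE]]] := phiS (t, x) t0.
by apply: (slice_differentiable oU Up t0 GE); exact: (CG 1%N).1.
Qed.

Lemma smooth_future_derive phi v : smooth_future phi ->
  smooth_future (fun t => 'D_v (phi t)).
Proof.
move=> phiS p p0; have [U [G [oU Up CG GE]]] := phiS p p0.
exists U, ('D_(0, v) G); split=> //; first by move=> k; exact: (CG k.+1).2.
by move=> [t x] q0 Uq; exact: (slice_derive oU Uq q0 GE).
Qed.

Lemma smooth_future_time_derive phi t x : smooth_future phi -> 0 <= t ->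
  exists v : R, is_time_derive (phi ^~ x) t v.
Proof.
move=> phiS t0; have [U [G [oU Up CG GE]]] := phiS (t, x) t0.
exists ('D_(1, 0) G (t, x)); apply: (time_derive_extension oU Up t0 GE).
by apply: diff_derivable; exact: (CG 1%N).1.
Qed.

(** Chain rule on a positive extension [G]; uniqueness of one-sided derivatives identifies [v] with
    ['D_(1, 0) G (t, x)]. *)
Lemma is_time_derive_ln phi t x (v : R) : smooth_future phi ->
  (forall t x, 0 <= t -> 0 < phi t x) -> 0 <= t ->
  is_time_derive (phi ^~ x) t v ->
  is_time_derive (fun s => ln (phi s x)) t ((phi t x)^-1 * v).
Proof.
move=> phiS phi0 t0 phiv.
have [U [G [oU Up CG G0 GE]]] := smooth_future_pos phiS phi0 (p := (t, x)) t0.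
have dG : differentiable G (t, x) by exact: (CG 1%N).1.
have vE : v = 'D_(1, 0) G (t, x).
  apply: (is_time_derive_unique t0 phiv).
  by apply: (time_derive_extension oU Up t0 GE); exact: diff_derivable.
have lE (q : R * V) : 0 <= q.1 -> U q -> ln (phi q.1 q.2) = ln (G q).
  by move=> q0 Uq; rewrite GE.
have dlG := differentiable_ln dG (G0 _ Up).
have := time_derive_extension (phi := fun s y => ln (phi s y)) oU Up t0 lE
  (diff_derivable dlG).
by rewrite derive_ln//; [rewrite -vE -(GE (t, x))|exact: G0].
Qed.

Section time_derivative_field.
Variables phi psi : R -> V -> R.
Hypothesis phiS : smooth_future phi.
Hypothesis phi_psi : forall t x, 0 <= t ->
  is_time_derive (phi ^~ x) t (psi t x).

Lemma time_derive_extensionE U G : open U -> (forall k, Ck k U G) ->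
  (forall q : R * V, 0 <= q.1 -> U q -> phi q.1 q.2 = G q) ->
  forall q : R * V, 0 <= q.1 -> U q -> psi q.1 q.2 = 'D_(1, 0) G q.
Proof.
move=> oU CG GE [t x] t0 Uq.
apply: (is_time_derive_unique t0 (@phi_psi t x t0)).
apply: (time_derive_extension oU Uq t0 GE).
by apply: diff_derivable; exact: (CG 1%N).1.
Qed.

(** [psi] is given only pointwise, as a time derivative, yet it agrees locally with ['D_(1, 0) G]
    for an extension [G] of [phi]. *)
Lemma smooth_future_dt : smooth_future psi.
Proof.
move=> p p0; have [U [G [oU Up CG GE]]] := phiS p0.
exists U, ('D_(1, 0) G); split=> //; first by move=> k; exact: (CG k.+1).2.
exact: time_derive_extensionE.
Qed.

(** Symmetry of the second derivatives of an extension in the directions [(0, v)] and [(1, 0)],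
    valid up to [t = 0]. *)
Lemma is_time_derive_derive t x v : 0 <= t ->
  is_time_derive (fun s => 'D_v (phi s) x) t ('D_v (psi t) x).
Proof.
move=> t0; have [U [G [oU Up CG GE]]] := @phiS (t, x) t0.
have psiE := time_derive_extensionE oU CG GE.
rewrite (slice_derive oU Up t0 psiE).
rewrite (@derive_comm R (R * V)%type U G (t, x) (0, v) (1, 0) oU Up (CG 2%N)).
apply: (time_derive_extension (phi := fun s => 'D_v (phi s)) oU Up t0).
  by move=> [s y] s0 Us; exact: (slice_derive oU Us s0 GE).
by apply: diff_derivable; exact: ((CG 2%N).2 _).1.
Qed.

End time_derivative_field.

End smooth_future.

(** * Material derivatives along the flow *)

Section flow.
Context {R : realType} {d : nat}.
Local Notation V := 'cV[R]_d.
Implicit Types (g h : R -> V -> R) (t : R) (x : V).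

Lemma smooth_future_entry (T : R -> V -> V) i : smooth_future T ->
  smooth_future (fun t x => T t x i 0).
Proof.
move=> TS p p0; have [U [G [oU Up CG GE]]] := TS p p0.
exists U, (fun q => G q i 0); split=> //; first by move=> k; exact: Ck_entry.
by move=> q q0 Uq; rewrite -GE.
Qed.

Lemma smooth_future_pderiv (phi : R -> V -> R) i : smooth_future phi ->
  smooth_future (fun t => pderiv i (phi t)).
Proof. exact: smooth_future_derive. Qed.

Lemma hessE (g : V -> R) z i j : hess g z i j = pderiv j (pderiv i g) z.
Proof.
rewrite mxE; congr (pderiv j _ z).
by apply/funext => y; rewrite mxE.
Qed.

Lemma divergence_tr (F : V -> V) z : divergence F z = \tr (jac F z).
Proof. by apply: eq_bigr => i _; rewrite mxE. Qed.

(** The differentiated expression has the shape of the right-hand side of the score equation; this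
    is the passage from the score to the Hessian. *)
Lemma pderiv_subNsumM (a b : 'I_d -> V -> R) (c : V -> R) z j :
  (forall i, differentiable (a i) z) -> (forall i, differentiable (b i) z) ->
  differentiable c z ->
  pderiv j (fun y => - (\sum_i a i y * b i y) - c y) z =
  - (\sum_i (a i z * pderiv j (b i) z + b i z * pderiv j (a i) z))
  - pderiv j c z.
Proof.
move=> da db dc; rewrite /pderiv; set v := delta_mx j 0.
have dab i : derivable (a i * b i) z v.
  by apply: derivableM; exact: diff_derivable.
have -> : (fun y => - (\sum_i a i y * b i y) - c y) =
    - (\sum_i (a i * b i)) - c.
  apply/funext => y; rewrite [RHS]/GRing.add/= [in RHS]/GRing.opp/=.
  by congr (- _ - _); rewrite fct_sumE.
have ds : derivable (\sum_i (a i * b i)) z v by exact: derivable_sum.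
rewrite deriveB; last 2 first.
- exact: derivableN.
- exact: diff_derivable.
congr (_ - _); rewrite deriveN// derive_sum//; congr (- _).
apply: eq_bigr => i _.
exact: (deriveM (diff_derivable (da i)) (diff_derivable (db i))).
Qed.

Variables (T f : R -> V -> V).
Hypothesis TS : smooth_future T.
Hypothesis T_bij : forall t, 0 <= t -> bijective (T t).
Hypothesis J_gt0 : forall t x, 0 <= t -> 0 < \det (jac (T t) x).
Hypothesis f_def : forall t x, 0 <= t ->
  is_time_derive (fun u => T u x) t (f t (T t x)).

Definition pullback g t x : R := g t (T t x).

Lemma jac_unit t x : 0 <= t -> jac (T t) x \in unitmx.
Proof. by move=> t0; rewrite unitmxE unitfE gt_eqF// J_gt0. Qed.

Lemma smooth_jac i j : smooth_future (fun t x => jac (T t) x i j).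
Proof.
apply: smooth_future_eq (smooth_future_pderiv j (smooth_future_entry i TS)).
by move=> t x _; rewrite mxE.
Qed.

Lemma flow_differentiable t x : 0 <= t -> differentiable (T t) x.
Proof. by move=> t0; exact: smooth_future_slice. Qed.

Lemma pullback_differentiable g t y : smooth_future (pullback g) -> 0 <= t ->
  differentiable (g t) y.
Proof.
move=> gS t0; have [S TK SK] := T_bij t0.
have dS : differentiable S y.
  apply: (@differentiable_inverse _ _ (T t) S) => //.
  - by move=> x; exact: flow_differentiable.
  - move=> i j x; apply: differentiable_continuous.
    apply: (smooth_future_slice (phi := fun t => pderiv j _) _ t0).
    exact: smooth_future_pderiv (smooth_future_entry i TS).
  - by move=> x; exact: jac_unit.
have -> : g t = pullback g t \o S.
  by apply/funext => z; rewrite /pullback /= SK.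
apply: differentiable_comp => //.
exact: smooth_future_slice.
Qed.

Lemma grad_pullback g t x : smooth_future (pullback g) -> 0 <= t ->
  grad (pullback g t) x = (jac (T t) x)^T *m grad (g t) (T t x).
Proof.
move=> gS t0; have dg := pullback_differentiable (T t x) gS t0.
have dT := flow_differentiable x t0.
apply/matrixP => i k; rewrite ord1 {k} !mxE.
have dgT : differentiable (g t \o T t) x by exact: differentiable_comp.
rewrite /pderiv (deriveE _ (dgT : differentiable (pullback g t) x)).
rewrite (diff_comp dT dg)/= -(deriveE _ dg) derive_pderiv//.
apply: eq_bigr => j _; rewrite !mxE; congr (_ * _).
rewrite -(deriveE _ dT) (derive_mx (diff_derivable dT)) mxE.
by [].
Qed.

(** Inverting the transposed Jacobian in [grad_pullback] writes the pullback of a partial derivative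
    in terms of smooth functions. Smooth pullbacks are thus stable under spatial derivatives, so the
    commutator rule can be iterated. *)
Lemma smooth_pullback_pderiv g j : smooth_future (pullback g) ->
  smooth_future (pullback (fun t => pderiv j (g t))).
Proof.
move=> gS.
apply: (@smooth_future_eq _ _ (fun t x => \sum_i invmx (jac (T t) x) i j *
    pderiv i (pullback g t) x)).
  move=> t x t0; have uJ := jac_unit x t0.
  have -> : pullback (fun t => pderiv j (g t)) t x =
      ((invmx (jac (T t) x))^T *m grad (pullback g t) x) j 0.
    by rewrite grad_pullback// mulmxA -trmx_mul mulmxV// trmx1 mul1mx mxE.
  by rewrite mxE; apply: eq_bigr => i _; rewrite !mxE.
apply: smooth_future_sum => i; apply: smooth_futureM.
  by apply: smooth_future_invmx => //; exact: smooth_jac.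
exact: smooth_future_pderiv.
Qed.

Lemma f_entry i t x : 0 <= t ->
  is_time_derive (fun u => T u x i 0) t (pullback (fun t y => f t y i 0) t x).
Proof.
move=> t0.
exact: (@is_time_derive_entry R d 1 (fun u => T u x) t _ i 0 (@f_def t x t0)).
Qed.

(** The pullback of the [i]-th entry of [f] is the time derivative of that of [T]. *)
Lemma smooth_pullback_field i : smooth_future (pullback (fun t y => f t y i 0)).
Proof.
apply: (smooth_future_dt (smooth_future_entry i TS)).
by move=> t x; exact: f_entry.
Qed.

(** The variational equation of the flow: time and space derivatives of [T] are exchanged, then the
    chain rule is applied to [f] composed with [T]. *)
Lemma is_time_derive_jac t x i j : 0 <= t ->
  is_time_derive (fun s => jac (T s) x i j) t
    ((jac (f t) (T t x) *m jac (T t) x) i j).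
Proof.
move=> t0.
have := @is_time_derive_derive R V _ _ (smooth_future_entry i TS)
  (@f_entry i) t x (delta_mx j 0) t0.
have -> : 'D_(delta_mx j 0) (pullback (fun t y => f t y i 0) t) x =
    grad (pullback (fun t y => f t y i 0) t) x j 0 by rewrite mxE.
rewrite grad_pullback//; last exact: smooth_pullback_field.
have -> : ((jac (T t) x)^T *m grad (fun y => f t y i 0) (T t x)) j 0 =
    (jac (f t) (T t x) *m jac (T t) x) i j.
  rewrite !mxE; apply: eq_bigr => k _; rewrite !mxE; exact: mulrC.
by apply: is_time_derive_eq => // s _; rewrite mxE.
Qed.

(* The commutator of the material derivative with a spatial derivative: both
   sides of [grad (g o T) = J^T (grad g) o T] are differentiated in time, where
   [J' = (jac f o T) J], and [J^T] is cancelled. *)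
Lemma material_derive_pderiv g h j t x :
  smooth_future (pullback g) -> smooth_future (pullback h) ->
  (forall t x, 0 <= t ->
    is_time_derive (pullback g ^~ x) t (pullback h t x)) -> 0 <= t ->
  is_time_derive (fun s => pderiv j (g s) (T s x)) t
    (pderiv j (h t) (T t x) - \sum_i pderiv i (g t) (T t x) *
       pderiv j (fun y => f t y i 0) (T t x)).
Proof.
move=> gS hS gh t0.
(* The derivatives [w k] exist because the pullbacks are smooth; it remains to compute them. *)
have [w wP] := choice (fun k => smooth_future_time_derive x
  (smooth_pullback_pderiv k gS) t0).
suff wE : forall k, w k = pderiv k (h t) (T t x) -
    \sum_i pderiv i (g t) (T t x) * pderiv k (fun y => f t y i 0) (T t x).
  by rewrite -wE; exact: wP.
move=> k; apply/eqP; rewrite -subr_eq0; apply/eqP.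
(* [u] collects the differences between the actual and the claimed derivatives; the invertible
   transposed Jacobian is shown to kill it. *)
pose u : V := \col_k (w k - (pderiv k (h t) (T t x) -
  \sum_i pderiv i (g t) (T t x) * pderiv k (fun y => f t y i 0) (T t x))).
suff u0 : (jac (T t) x)^T *m u = 0.
  have : u = 0.
    rewrite -(mulKmx (_ : (jac (T t) x)^T \in unitmx) u) ?u0 ?mulmx0//.
    by rewrite unitmx_tr jac_unit.
  by move=> /matrixP/(_ k 0); rewrite !mxE.
apply/matrixP => i l; rewrite ord1 {l}.
(* One function of time is differentiated in two ways: here by the product rule, in [H2] by
   recognizing a partial derivative of the pullback of [g] and exchanging derivatives. *)
have H1 : is_time_derive (fun s => \sum_l pderiv l (g s) (T s x) *
    jac (T s) x l i) t (\sum_l (w l * jac (T t) x l i +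
    pderiv l (g t) (T t x) * (jac (f t) (T t x) *m jac (T t) x) l i)).
  apply: is_time_derive_sum => l.
  exact: (is_time_deriveM (wP l) (@is_time_derive_jac t x l i t0)).
have H2 : is_time_derive (fun s => \sum_l pderiv l (g s) (T s x) *
    jac (T s) x l i) t (grad (pullback h t) x i 0).
  rewrite [grad _ _ _ _]mxE.
  have := @is_time_derive_derive R V _ _ gS gh t x (delta_mx i 0) t0.
  apply: is_time_derive_eq => // s s0.
  have -> : 'D_(delta_mx i 0) (pullback g s) x = grad (pullback g s) x i 0.
    by rewrite mxE.
  rewrite grad_pullback// mxE; apply: eq_bigr => l _.
  by rewrite !mxE mulrC.
have := is_time_derive_unique t0 H1 H2; rewrite grad_pullback//.
move=> E; apply/eqP.
have -> : ((jac (T t) x)^T *m u) i 0 =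
  \sum_l (w l * jac (T t) x l i + pderiv l (g t) (T t x) *
     (jac (f t) (T t x) *m jac (T t) x) l i) -
  ((jac (T t) x)^T *m grad (h t) (T t x)) i 0.
  rewrite big_split/=.
  have -> : \sum_l pderiv l (g t) (T t x) *
      (jac (f t) (T t x) *m jac (T t) x) l i =
      \sum_l (\sum_i0 pderiv i0 (g t) (T t x) *
        pderiv l (fun y => f t y i0 0) (T t x)) * jac (T t) x l i.
    under eq_bigr do rewrite mxE mulr_sumr.
    under [RHS]eq_bigr do rewrite mulr_suml.
    rewrite exchange_big; apply: eq_bigr => a _; apply: eq_bigr => b _.
    by rewrite mulrA; congr (_ * _ * _); rewrite mxE.
  rewrite -big_split/= mxE [X in _ = _ - X]mxE -sumrB.
  apply: eq_bigr => l _; rewrite !mxE; ring.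
by rewrite E subrr mxE.
Qed.

End flow.

(** * The evolution equations along the trajectory *)

Theorem proposition1 (R : realType) (d : nat)
    (dsp : measure_display) (Om : measurableType dsp) (P : probability Om R)
    (T : R -> 'cV[R]_d -> 'cV[R]_d)
    (z0 : {RV P >-> borelV R d})
    (rho : R -> 'cV[R]_d -> R)
    (f : R -> 'cV[R]_d -> 'cV[R]_d)
    (T_smooth : smooth_on [set p : R * 'cV[R]_d | 0 <= p.1]
                  (fun p : R * 'cV[R]_d => T p.1 p.2))
    (T_bij : forall t : R, 0 <= t -> bijective (T t))
    (T_0 : forall x : 'cV[R]_d, T 0 x = x)
    (rho0_smooth : smooth_on [set: 'cV[R]_d] (rho 0))
    (rho0_gt0 : forall x : 'cV[R]_d, 0 < rho 0 x)
    (rho0_density : has_density P z0 (rho 0))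
    (rho_density : forall t : R, 0 <= t ->
       has_density P (fun w : Om => T t (z0 w)) (rho t))
    (monge_ampere : forall (t : R) (x : 'cV[R]_d), 0 <= t ->
       rho t (T t x) * \det (jac (T t) x) = rho 0 x)
    (f_def : forall (t : R) (x : 'cV[R]_d), 0 <= t ->
       is_time_derive (fun u : R => T u x) t (f t (T t x)))
    (w : Om) :
  let z (t : R) : 'cV[R]_d := T t (z0 w) in
  let l (t : R) : R := ln (rho t (z t)) in
  let ltilde (t : R) : R := rho t (z t) in
  let s (t : R) : 'cV[R]_d := grad (fun y => ln (rho t y)) (z t) in
  let H (t : R) : 'M[R]_d := hess (fun y => ln (rho t y)) (z t) in
  forall t : R, 0 <= t ->
  [/\ is_time_derive z t (f t (z t)),
      is_time_derive l t (- divergence (f t) (z t)),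
      is_time_derive s t
        (- ((jac (f t) (z t))^T *m s t) - grad (divergence (f t)) (z t)),
      is_time_derive H t
        (- (\sum_(i < d) s t i 0 *: hess (fun y => f t y i 0) (z t))
         - hess (divergence (f t)) (z t)
         - H t *m jac (f t) (z t) - (jac (f t) (z t))^T *m H t) &
      is_time_derive ltilde t (- (divergence (f t) (z t)) * ltilde t)].
Proof.
move=> z l ltilde s H t t0.
have TS : smooth_future T by exact: T_smooth.
(* The density is nonnegative and its product with the determinant is positive, so the determinant
   is positive. *)
have J0 u x : 0 <= u -> 0 < \det (jac (T u) x).
  move=> u0; have [rho_ge0 _ _] := rho_density u u0.
  have := rho0_gt0 x; rewrite -(monge_ampere u x u0) [X in _ -> is_true X]ltNge.
  by apply: contraL => J_le0; rewrite -leNgt mulr_ge0_le0.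
pose D u y := divergence (f u) y.
pose lam u y := ln (rho u y).
(* The Monge-Ampere equation solved for the density: the source of positivity and smoothness of its
   pullback. *)
have rhoE u x : 0 <= u -> rho 0 x * (\det (jac (T u) x))^-1 = rho u (T u x).
  by move=> u0; rewrite -(monge_ampere u x u0) mulfK// gt_eqF// J0.
have rho_pos u x : 0 <= u -> 0 < pullback T rho u x.
  by move=> u0; rewrite /pullback -rhoE// divr_gt0// J0.
have jacS := smooth_jac TS.
have rhoS : smooth_future (pullback T rho).
  apply: smooth_future_eq (smooth_futureM (smooth_future_snd rho0_smooth)
    (smooth_futureV (smooth_future_det jacS) J0)).
  by move=> u x u0; exact: rhoE.
have lamS : smooth_future (pullback T lam).
  exact: (smooth_future_ln rhoS rho_pos).
have fS := smooth_pullback_field TS f_def.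
have pS g j := @smooth_pullback_pderiv _ _ T TS T_bij J0 g j.
have DS : smooth_future (pullback T D).
  by apply: smooth_future_sum => i; exact: pS.
have drho u x : 0 <= u ->
    is_time_derive (pullback T rho ^~ x) u (- D u (T u x) * rho u (T u x)).
  move=> u0; have [v rv] := smooth_future_time_derive x rhoS u0.
  have dJ : is_time_derive (fun s => \det (jac (T s) x)) u
      (\det (jac (T u) x) * D u (T u x)).
    rewrite /D divergence_tr; apply: is_time_derive_det => i j.
    exact: is_time_derive_jac.
  (* The left-hand side of the Monge-Ampere equation is constant in time; the product rule and
     Jacobi's formula then determine [v]. *)
  have c0 : is_time_derive (fun s => pullback T rho s x * \det (jac (T s) x))
      u 0.
    apply: is_time_derive_eq (is_time_derive_cst (rho 0 x) u) => // s' s'0.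
    by rewrite /pullback monge_ampere.
  have E := is_time_derive_unique u0 c0 (is_time_deriveM rv dJ).
  have vE : v * \det (jac (T u) x) =
      - (rho u (T u x) * (\det (jac (T u) x) * D u (T u x))).
    by apply/eqP; rewrite -addr_eq0 -E.
  suff -> : - D u (T u x) * rho u (T u x) = v by [].
  apply: (mulIf (lt0r_neq0 (J0 u x u0))).
  by rewrite vE; ring.
have dlam u x : 0 <= u ->
    is_time_derive (pullback T lam ^~ x) u
      (pullback T (fun u y => - D u y) u x).
  move=> u0.
  have := is_time_derive_ln rhoS rho_pos u0 (drho u x u0).
  by rewrite mulrC mulfK// gt_eqF// rho_pos.
have NS g : smooth_future (pullback T g) ->
    smooth_future (pullback T (fun u y => - g u y)).
  move=> gS.
  apply: smooth_future_eq (smooth_futureM (smooth_future_cst (-1)) gS).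
  by move=> u x _; rewrite mulN1r.
have dif g y := @pullback_differentiable _ _ T TS T_bij J0 g t y.
(* The [k]-th entry of the right-hand side of the score equation, as a function of time and
   position, so that the commutator rule can take it as input. *)
pose h k u y := - (\sum_i pderiv i (lam u) y *
    pderiv k (fun y => f u y i 0) y) - pderiv k (D u) y.
have hS k : smooth_future (pullback T (h k)).
  have S1 i := smooth_futureM (pS _ i lamS) (pS _ k (fS i)).
  have S2 := smooth_future_sum (index_enum 'I_d) S1.
  pose g u y := \sum_i pderiv i (lam u) y * pderiv k (fun y => f u y i 0) y.
  exact: (smooth_futureD (NS g S2) (NS (fun u => pderiv k (D u)) (pS _ k DS))).
(* First use of the commutator rule: on [lam], whose material derivative is [- D]. *)
have ds k u x : 0 <= u ->
    is_time_derive (pullback T (fun u => pderiv k (lam u)) ^~ x) u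
      (pullback T (h k) u x).
  move=> u0.
  have := @material_derive_pderiv R d T f TS T_bij J0 f_def lam
    (fun u y => - D u y) k u x lamS (NS D DS) dlam u0.
  congr is_time_derive.
  rewrite /pullback /h addrC; congr (_ + _).
  rewrite /pderiv [LHS]deriveN//; apply: diff_derivable.
  exact: (@pullback_differentiable _ _ T TS T_bij J0 D u).
(* Second use: on the [k]-th entry of the score, whose material derivative is [h k]. *)
have dH k j x := @material_derive_pderiv R d T f TS T_bij J0 f_def
  (fun u => pderiv k (lam u)) (h k) j t x (pS _ k lamS) (hS k) (ds k) t0.
split.
- exact: f_def.
- exact: dlam.
- apply: is_time_derive_mx => // k j; rewrite ord1 {j}.
  have := ds k t (z0 w) t0.
  rewrite /h /pullback.
  have -> : (- ((jac (f t) (z t))^T *m s t) - grad (divergence (f t)) (z t)) k 0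
    = - (\sum_i pderiv i (lam t) (T t (z0 w)) *
        pderiv k (fun y => f t y i 0) (T t (z0 w)))
      - pderiv k (D t) (T t (z0 w)).
    rewrite !mxE; congr (- _ - _).
    by apply: eq_bigr => i _; rewrite !mxE mulrC.
  by apply: is_time_derive_eq => // u _; rewrite mxE.
- apply: is_time_derive_mx => // k j.
  have := dH k j (z0 w).
  have da i : differentiable (pderiv i (lam t)) (z t).
    by apply: (dif (fun u => pderiv i (lam u))); first exact: pS.
  have db i : differentiable (pderiv k (fun y => f t y i 0)) (z t).
    by apply: (dif (fun u => pderiv k (fun y => f u y i 0))); first exact: pS.
  have dc : differentiable (pderiv k (D t)) (z t).
    by apply: (dif (fun u => pderiv k (D u))); first exact: pS.
  rewrite [pderiv j (h k t) _](pderiv_subNsumM _ da db dc).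
  have entryE (A B C E : 'M[R]_d) :
      (- A - B - C - E) k j = - A k j - B k j - C k j - E k j.
    by rewrite !mxE.
  (* [a] and [e] are the two halves of the product rule for [h k], giving the Hessians of the
     entries of [f] and the term with the transposed Jacobian; [b] is the Hessian of the divergence
     and [c] the commutator term, with the Jacobian on the right. *)
  have sw (a b c e : R) : - (a + e) - b - c = - a - b - c - e by ring.
  have -> : (fun u => H u k j) = (fun u => pderiv j (pderiv k (lam u)) (z u)).
    by apply/funext => u; exact: hessE.
  congr is_time_derive.
  rewrite big_split [LHS]sw; apply: (etrans _ (esym (entryE _ _ _ _))).
  congr (- _ - _ - _ - _).
  + rewrite summxE; apply: eq_bigr => i _.
    by rewrite mxE hessE mxE.
  + by rewrite hessE.
  + rewrite mxE; apply: eq_bigr => i _.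
    by rewrite hessE [jac _ _ _ _]mxE.
  + rewrite mxE; apply: eq_bigr => i _.
    by rewrite hessE mxE [jac _ _ _ _]mxE.
- exact: drho.
Qed.
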